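(* Let $(\Omega,\mathcal F,\mathbb P)$ be a nonatomic probability space, $1\le p<\infty$, $\alpha\in(0,1)$, and let $S=(S_0,S_T)$ be a traded asset with $S_T\in L^p_+$. The following statements are equivalent: (a) $\rho_{\mathcal A^\alpha,S}$ is finitely valued on $L^p$; (b) $\rho_{\mathcal A^\alpha,S}$ is Lipschitz continuous on $L^p$; (c) $\operatorname{TVaR}_\alpha(S_T)<0$; (d) $\mathbb P(S_T=0)<\alpha$.
   Context: $L^p=L^p(\Omega,\mathcal F,\mathbb P)$ with its usual norm and almost sure order, positive cone $L^p_+$. A traded asset is a pair $S=(S_0,S_T)$ with $S_0>0$ real and $S_T\in L^p_+$ nonzero. For $\beta\in(0,1)$, $\operatorname{VaR}_\beta(X)=\inf\{m\in\mathbb R : \mathbb P(X+m<0)\le\beta\}$, and $\operatorname{TVaR}_\alpha(X)=\frac1\alpha\int_0^\alpha\operatorname{VaR}_\beta(X)\,d\beta$. Set $\mathcal A^\alpha=\{X\in L^p : \operatorname{TVaR}_\alpha(X)\le0\}$ and define $\rho_{\mathcal A^\alpha,S}:L^p\to\mathbb R\cup\{\pm\infty\}$ by $$\rho_{\mathcal A^\alpha,S}(X)=\inf\{m\in\mathbb R : \operatorname{TVaR}_\alpha(X+\tfrac{m}{S_0}S_T)\le0\},\qquad \inf\emptyset=\infty.$$ Lipschitz continuous means real-valued and Lipschitz with respect to the $L^p$ norm. *)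

(* Defs.v *)
From HB Require Import structures.
From mathcomp Require Import all_boot all_order all_algebra.
From mathcomp Require Import all_classical all_reals all_analysis.

Set Implicit Arguments.
Unset Strict Implicit.
Unset Printing Implicit Defensive.
Import Order.TTheory GRing.Theory Num.Theory.
Import numFieldNormedType.Exports.

Local Open Scope classical_set_scope.
Local Open Scope ring_scope.

Definition nonatomic d (T : measurableType d) (R : realType)
    (P : probability T R) : Prop :=
  forall A : set T, measurable A -> (0 < P A)%E ->
    exists B : set T,
      [/\ measurable B, B `<=` A, (0 < P B)%E & (P B < P A)%E].

(* [VaR], [TVaR] and [rho] take values in \bar R, so that every infimum is the
   genuine one: in particular the infimum of the empty set is +oo. *)
Section tail_value_at_risk.
Context d (T : measurableType d) (R : realType) (P : probability T R).
Implicit Types (alpha beta : R) (X Y : T -> R).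

Definition VaR beta X : \bar R :=
  ereal_inf [set m%:E | m in
    [set m : R | (P [set t | (X t + m < 0)%R] <= beta%:E)%E]].

Definition TVaR alpha X : \bar R :=
  ((alpha^-1)%:E * \int[lebesgue_measure]_(beta in `]0%R, alpha[) VaR beta X)%E.

Lemma VaR_ae beta X Y : measurable_fun setT X -> measurable_fun setT Y ->
  ae_eq P setT X Y -> VaR beta X = VaR beta Y.
Proof.
move=> mX mY [N [mN PN0 XYN]]; congr ereal_inf; congr image.
apply/funext => m /=.
have meas (Z : T -> R) : measurable_fun setT Z ->
    measurable [set t | (Z t + m < 0)%R].
  move=> mZ; rewrite -[X in measurable X]setTI.
  have -> : [set t | (Z t + m < 0)%R] = (fun t => Z t + m) @^-1` `]-oo, 0[.
    by apply/seteqP; split => t /=; rewrite in_itv.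
  exact: (measurable_realfun.measurable_funD mZ (measurable_cst m)).
suff -> : P [set t | (X t + m < 0)%R] = P [set t | (Y t + m < 0)%R] by [].
rewrite -(measureU0 (meas _ mX) mN PN0) -(measureU0 (meas _ mY) mN PN0).
have XY t : ~ N t -> X t = Y t.
  by move=> Nt; apply: contrapT => XYt; apply/Nt/XYN => /(_ I).
congr (P _); apply/seteqP; split => t /= [|]; [|by right| |by right];
  by case: (pselect (N t)) => [|/XY ->]; [right|left].
Qed.

Lemma TVaR_ae alpha X Y : measurable_fun setT X -> measurable_fun setT Y ->
  ae_eq P setT X Y -> TVaR alpha X = TVaR alpha Y.
Proof.
by move=> mX mY XY; congr (_ * _)%E; apply: eq_integral => b _; exact: VaR_ae.
Qed.

End tail_value_at_risk.

(* L^p is represented by the type [LfunType P p1] of its p-integrable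
   measurable representatives. Statements about elements of L^p only involve
   almost sure relations, and the functionals on it are invariant under almost
   sure equality (lemmas [VaR_ae], [TVaR_ae] and [rho_TVaR_ae]). *)
Section risk_measure.
Context d (T : measurableType d) (R : realType) (P : probability T R).
Context (p : \bar R) (p1 : (1 <= p)%E).
Local Notation Lp := (LfunType P p1).

Record tradedAsset := TradedAsset {
  price : R ;
  payoff : Lp ;
  price_gt0 : 0 < price ;
  payoff_ge0 : {ae P, forall t, 0 <= payoff t} ;
  payoff_neq0 : ~ ae_eq P setT payoff (cst 0) }.

Definition accTVaR (alpha : R) : set Lp := [set X : Lp | (TVaR P alpha X <= 0)%E].

Definition rho (A : set Lp) (S : tradedAsset) (X : Lp) : \bar R :=
  ereal_inf [set m%:E | m in
    [set m : R | A (X + (m / price S) *: payoff S)]].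

Definition finitely_valued (f : Lp -> \bar R) : Prop :=
  forall X : Lp, f X \is a fin_num.

(* The library only defines Lipschitz maps between normed modules, a structure
   that [LfunType] does not carry. *)
Definition Lipschitz_continuous (f : Lp -> \bar R) : Prop :=
  finitely_valued f /\
  exists2 k : R, 0 <= k &
    forall X Y : Lp,
      (`|f X - f Y| <= k%:E * 'N[P]_p[EFin \o ((X - Y)%R : Lp)])%E.

Lemma eq_rho (A : set Lp) (S : tradedAsset) (X Y : Lp) :
  (forall m : R, A (X + m *: payoff S) = A (Y + m *: payoff S)) ->
  rho A S X = rho A S Y.
Proof. by move=> XY; rewrite /rho; under eq_fun do rewrite XY. Qed.

Lemma rho_TVaR_ae (alpha : R) (S : tradedAsset) (X Y : Lp) :
  ae_eq P setT X Y -> rho (accTVaR alpha) S X = rho (accTVaR alpha) S Y.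
Proof.
move=> XY; apply: eq_rho => m; rewrite /accTVaR/mkset.
suff TE : TVaR P alpha (X + m *: payoff S) = TVaR P alpha (Y + m *: payoff S).
  by rewrite TE.
apply: TVaR_ae; [exact: measurable_funPT|exact: measurable_funPT|].
apply: filterS XY => t XYt tT.
rewrite -[LHS]/(X t + m * payoff S t) -[RHS]/(Y t + m * payoff S t).
by rewrite XYt.
Qed.

End risk_measure.

(* Main.v *)
(* The quantile function [b |-> VaR_b X] on ]0, 1[ has the law of [- X] under
   the uniform law, which gives the Rockafellar-Uryasev formula
   [TVaR_a X = min_s (s + a^-1 E[(- X - s)^+])], attained at [s = VaR_a X].
   Hence TVaR is subadditive, positively homogeneous and bounded by
   [a^-1 E|X|]. If [TVaR_a S_T < 0], adding [k >= 0] units of [S_T] lowers TVaR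
   by at least [- k TVaR_a S_T], so rho is finite and Lipschitz with constant
   [S_0 / (a |TVaR_a S_T|)]. If [P(S_T = 0) >= a], no multiple of [S_T] makes
   the constant position [-1] acceptable, so rho takes the value [+oo] there. *)
Require Import Defs.
From HB Require Import structures.
From mathcomp Require Import all_boot all_order all_algebra.
From mathcomp Require Import all_classical all_reals all_analysis.
From mathcomp Require Import measurable_realfun ring lra.
Import Order.TTheory GRing.Theory Num.Theory.
Import numFieldNormedType.Exports.
Local Open Scope classical_set_scope.
Local Open Scope ring_scope.
Set Implicit Arguments.
Unset Strict Implicit.
Unset Printing Implicit Defensive.

(** * Value at risk as a generalised inverse of the shortfall probability *)

Section value_at_risk.
Context d (T : measurableType d) (R : realType) (P : probability T R).
Implicit Types (X : {mfun T >-> R}) (b s m : R).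
Local Open Scope ereal_scope.

Lemma measurable_shortfall X m : measurable [set t | (X t + m < 0)%R].
Proof.
rewrite -[X in measurable X]setTI.
have -> : [set t | (X t + m < 0)%R] = (fun t => X t + m)%R @^-1` `]-oo, 0%R[.
  by apply/seteqP; split => t /=; rewrite in_itv.
exact: (measurable_funD (measurable_funPT X) (measurable_cst m)).
Qed.

Lemma le_shortfall X m m' : (m <= m')%R ->
  P [set t | (X t + m' < 0)%R] <= P [set t | (X t + m < 0)%R].
Proof.
move=> mm'; apply: le_measure; rewrite ?inE; do ?exact: measurable_shortfall.
by move=> t /=; apply: le_lt_trans; rewrite lerD2l.
Qed.

(** The strict Galois connection holds because [m |-> P(X + m < 0)] is nonincreasing and
    right-continuous. All later information on the law of the quantile function comes from it. *)
Lemma VaR_gtP X b s : s%:E < VaR P b X <-> b%:E < P [set t | (X t + s < 0)%R].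
Proof.
split => [|bP].
  rewrite !ltNge; apply: contra => sb.
  by apply: ereal_inf_lbound; exists s.
(* Right-continuity at [s]: the events [F n] increase to [{X + s < 0}], so some [F n] already has
   mass above [b], and [s + n.+1%:R^-1] is a lower bound of [VaR] strictly above [s]. *)
pose F n := [set t | (X t + (s + n.+1%:R^-1) < 0)%R].
have cvgF : P \o F @ \oo --> P (\bigcup_n F n).
  apply: nondecreasing_cvg_mu => [n||].
  - exact: measurable_shortfall.
  - by apply: bigcup_measurable => n _; exact: measurable_shortfall.
  - move=> m n mn; apply/subsetPset => t /=; apply: le_lt_trans.
    by rewrite !lerD2l lef_pV2 ?posrE// ler_nat.
have FE : \bigcup_n F n = [set t | (X t + s < 0)%R].
  apply/seteqP; split => t /=.
    by case=> n _; apply: le_lt_trans; rewrite lerD2l lerDl.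
  move=> Xs; have e0 : (0 < - (X t + s))%R by rewrite oppr_gt0.
  have [n _ /(_ n (leqnn n)) nP] := near_infty_natSinv_lt (PosNum e0).
  by exists n => //; rewrite /F/= addrA -ltrBrDl sub0r.
have [n bF] : exists n, b%:E < P (F n).
  apply: contrapT => /forallNP nF; move: bP; rewrite -FE -(cvg_lim _ cvgF)//.
  apply/negP; rewrite -leNgt; apply: lime_le.
    by apply/cvg_ex; exists (P (\bigcup_n F n)).
  by apply: nearW => n /=; rewrite leNgt; exact/negP.
apply: (@lt_le_trans _ _ (s + n.+1%:R^-1)%:E); first by rewrite lte_fin ltrDl.
apply: le_ereal_inf_tmp => _ [m /= mb <-]; rewrite lee_fin leNgt.
apply/negP => /ltW /(le_shortfall X) /(lt_le_trans bF).
by rewrite ltNge mb.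
Qed.

Lemma VaR_nonincreasing X b b' : (b <= b')%R -> VaR P b' X <= VaR P b X.
Proof.
move=> bb'; apply: ereal_inf_le_tmp; apply: image_subset => m /= /le_trans.
by apply; rewrite lee_fin.
Qed.

(** The limits 1 and 0 of the cdf at the two infinities give one level whose shortfall probability
    exceeds [b] and one where it stays below. *)
Lemma VaR_fin_num X b : (0 < b < 1)%R -> VaR P b X \is a fin_num.
Proof.
move=> /andP[b0 b1]; rewrite fin_numE; apply/andP; split; apply/eqP => VaRE.
- have [M MP] : exists M : R, b%:E < cdf (P := P) X M.
    have /open_ereal_gt' /cvg_cdfy1 : b%:E < 1 by rewrite lte_fin.
    move=> /(_ _ _ P X)[M [_ /(_ (M + 1)%R)]]; rewrite ltrDl ltr01.
    by move=> /(_ isT) ?; exists (M + 1)%R.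
  (* The extra 1 places [{X <= M}] inside the strict event [{X < M + 1}]. *)
  suff : (- (M + 1))%:E < VaR P b X by rewrite VaRE.
  apply/VaR_gtP; apply: (lt_le_trans MP).
  rewrite -[cdf X M]/(P (X @^-1` `]-oo, M])); apply: le_measure.
  + by rewrite inE; exact: measurable_sfunP.
  + by rewrite inE; exact: measurable_shortfall.
  + by move=> t /=; rewrite in_itv/=; lra.
- have [M MP] : exists M : R, cdf (P := P) X M < b%:E.
    have /open_ereal_lt' /cvg_cdfNy0 : 0 < b%:E by rewrite lte_fin.
    move=> /(_ _ _ P X)[M [_ /(_ (M - 1)%R)]]; rewrite ltrBlDr ltrDl ltr01.
    by move=> /(_ isT) ?; exists (M - 1)%R.
  have : (- M)%:E < VaR P b X by rewrite VaRE ltry.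
  move/VaR_gtP => bM; have := lt_trans MP bM; apply/negP; rewrite -leNgt.
  rewrite -[cdf X M]/(P (X @^-1` `]-oo, M])); apply: le_measure.
  + by rewrite inE; exact: measurable_shortfall.
  + by rewrite inE; exact: measurable_sfunP.
  + by move=> t /=; rewrite in_itv/=; lra.
Qed.

End value_at_risk.

(** * Layer-cake formula and the law of the quantile function *)

Lemma measurable_excess d (T : measurableType d) (R : realType) (D : set T)
    (f : T -> R) (s : R) : measurable_fun D f ->
  measurable_fun D (fun t => Num.max (f t - s) 0).
Proof.
move=> mf; have mfs := measurable_funB mf (measurable_cst s).
exact: (measurable_funrpos mfs).
Qed.

Lemma ge0_integral_tail d (T : measurableType d) (R : realType)
    (P : probability T R) (f : T -> R) : measurable_fun setT f ->
  (forall t, 0 <= f t)%R ->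
  (\int[P]_t (f t)%:E =
   \int[lebesgue_measure]_(r in `[0%R, +oo[) P [set t | (r < f t)%R])%E.
Proof.
move=> mf f0; have := @ge0_expectation_ccdf _ _ _ P (mfun_Sub (mem_set mf)) f0.
rewrite expectation_def => ->; apply: eq_integral => r _.
by congr (P _); apply/seteqP; split => t /=; rewrite in_itv/= andbT.
Qed.

Section excess.
Context d (T : measurableType d) (R : realType) (P : probability T R).
Local Open Scope ereal_scope.
Notation mu := (@lebesgue_measure R).

Implicit Types (X : {mfun T >-> R}) (b s m : R).

(** By [VaR_gtP]; a probability is at most 1, so [b < 1] is automatic on the right. The length of
    this interval is the tail of [- X] at [s], which identifies the law of the quantile function. *)
Lemma VaR_gt_itv X s : [set b | (0 < b < 1)%R /\ (s < fine (VaR P b X))%R] =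
  `]0%R, fine (P [set t | (X t + s < 0)%R])[%classic.
Proof.
have Pfin : P [set t | (X t + s < 0)%R] \is a fin_num.
  by apply: fin_num_measure; exact: measurable_shortfall.
have P1 : (fine (P [set t | (X t + s < 0)%R]) <= 1)%R.
  by rewrite -lee_fin fineK//; apply/probability_le1/measurable_shortfall.
apply/seteqP; split => b /=; rewrite in_itv/=.
  move=> [b01]; have /andP[-> _] := b01; rewrite -lte_fin fineK ?VaR_fin_num//.
  by move/VaR_gtP; rewrite -{1}(fineK Pfin) lte_fin.
move=> /andP[b0 bP]; have b01 : (0 < b < 1)%R by rewrite b0 (lt_le_trans bP).
split => //; rewrite -lte_fin fineK ?VaR_fin_num//; apply/VaR_gtP.
by rewrite -(fineK Pfin) lte_fin.
Qed.

Lemma measurable_VaR X :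
  measurable_fun (`]0%R, 1%R[%classic : set R) (fun b => fine (VaR P b X)).
Proof.
apply: (measurability _ (RGenOInfty.measurableE R)) => _ [_ [s ->] <-].
suff -> : `]0%R, 1%R[ `&` (fun b => fine (VaR P b X)) @^-1` `]s, +oo[ =
  `]0%R, fine (P [set t | (X t + s < 0)%R])[%classic by exact: measurable_itv.
rewrite -VaR_gt_itv; apply/seteqP; split => b /=; rewrite !in_itv/= andbT//.
Qed.

(* Both integrands have the same tail function, by [VaR_gt_itv]. *)
Lemma integral_VaR_excess X s :
  \int[mu]_(b in `]0%R, 1%R[) (Num.max (fine (VaR P b X) - s) 0)%:E =
  \int[P]_t (Num.max (- X t - s) 0)%:E.
Proof.
(* Extension by zero makes [g] a nonnegative function on the whole line, so that the tail formula
   applies to it under the uniform law. *)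
pose g := (fun b => Num.max (fine (VaR P b X) - s) 0)%R \_ `]0%R, 1%R[.
have mg : measurable_fun [set: R] g.
  apply: (measurable_restrictT _ _).1 => //; apply: measurable_excess.
  exact: measurable_VaR.
have g0 b : (0 <= g b)%R.
  by rewrite /g patchE; case: ifPn => // _; rewrite le_max lexx orbT.
pose U : probability _ R := uniform_prob (@ltr01 R).
transitivity (\int[U]_b (g b)%:E).
  rewrite integral_uniform//; last exact/measurable_EFinP.
  rewrite subr0 invr1 mul1e integral_itv_bndoo; last first.
    by apply/measurable_funTS/measurable_EFinP.
  by apply: eq_integral => b b01; rewrite /g patchE b01.
rewrite ge0_integral_tail// [RHS]ge0_integral_tail; last 2 first.
- apply: measurable_excess.
  exact: measurableT_comp.
- by move=> t; rewrite le_max lexx orbT.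
apply: eq_integral => r /[!inE]/=; rewrite in_itv/= andbT => r0.
have -> : [set t | (r < Num.max (- X t - s) 0)%R] =
    [set t | (X t + (s + r) < 0)%R].
  by apply/seteqP; split => t /=; rewrite lt_max (ltNge r 0%R) r0 orbF; lra.
pose a := fine (P [set t | (X t + (s + r) < 0)%R]).
have aE : P [set t | (X t + (s + r) < 0)%R] = a%:E.
  by rewrite fineK// fin_num_measure//; exact: measurable_shortfall.
have -> : [set b | (r < g b)%R] = `]0%R, a[%classic.
  rewrite -VaR_gt_itv; apply/seteqP; split => b /=; rewrite /g patchE.
    case: ifPn => [|_]; last by rewrite ltNge r0.
    rewrite inE/= in_itv/= => -> /=; rewrite lt_max (ltNge r 0%R) r0 orbF.
    by split=> //; lra.
  move=> [b01 bs]; rewrite ifT ?inE//= lt_max; apply/orP; left; lra.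
have a0 : (0 <= a)%R by rewrite -lee_fin -aE.
have a1 : (a <= 1)%R.
  by rewrite -lee_fin -aE; apply/probability_le1/measurable_shortfall.
rewrite aE.
have := @integral_indic _ _ _ U _ measurableT _ (measurable_itv `]0%R, a[).
rewrite setIT => <-.
rewrite integral_uniform//; last exact/measurable_EFinP/measurable_indic.
rewrite subr0 invr1 mul1e integral_indic// (_ : _ `&` _ = `]0%R, a[%classic).
  rewrite -[LHS]/(mu `]0%R, a[%classic) lebesgue_measure_itv/= lte_fin sube0.
  by case: ltP => // ?; congr EFin; lra.
by apply/seteqP; split => b /=; rewrite !in_itv/=; [case|split => //]; lra.
Qed.

End excess.

(** * The Rockafellar-Uryasev formula and its consequences for TVaR *)

Lemma integrable_max0 d (T : measurableType d) (R : realType)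
    (mu : {measure set T -> \bar R}) (D : set T) (f : T -> R) : measurable D ->
  mu.-integrable D (EFin \o f) ->
  mu.-integrable D (fun t => (Num.max (f t) 0)%:E).
Proof.
move=> mD /[dup] /measurable_int /measurable_EFinP mf.
apply: le_integrable => //.
  exact/measurable_EFinP/(measurable_funrpos mf).
move=> t _; rewrite !abse_EFin lee_fin ger0_norm ?le_max ?lexx ?orbT//.
by rewrite ge_max normr_ge0 ler_norm.
Qed.

Section rockafellar_uryasev.
Context d (T : measurableType d) (R : realType) (P : probability T R).
Local Open Scope ereal_scope.
Notation mu := (@lebesgue_measure R).
Implicit Types (X Y : {mfun T >-> R}) (s : R).

(** The stop-loss transform of the loss [- X]; [fine] loses nothing for integrable [X], by
    [excessE]. *)
Definition excess X s : R := fine (\int[P]_t (Num.max (- X t - s) 0)%:E).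

Lemma integrable_excess X s : P.-integrable setT (EFin \o X) ->
  P.-integrable setT (fun t => (Num.max (- X t - s) 0)%:E).
Proof.
move=> iX; apply: (integrable_max0 (f := fun t => - X t - s)%R) => //.
have iXs := integrableB measurableT (integrableN iX)
  (finite_measure_integrable_cst P s measurableT).
by apply: eq_integrable iXs => //= t _; rewrite EFinB EFinN.
Qed.

Lemma excessE X s : P.-integrable setT (EFin \o X) ->
  \int[P]_t (Num.max (- X t - s) 0)%:E = (excess X s)%:E.
Proof.
by move=> iX; rewrite fineK// integrable_fin_num//; exact: integrable_excess.
Qed.

Variables (alpha : R) (alpha01 : (0 < alpha < 1)%R).
Let D : set R := `]0%R, alpha[%classic.
Let q X b := fine (VaR P b X).

Let alpha0 : (0 < alpha)%R. Proof. by case/andP: alpha01. Qed.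

Let subD b : D b -> (0 < b < 1)%R.
Proof.
by rewrite /D/= in_itv/= => /andP[-> /lt_trans]; apply; case/andP: alpha01.
Qed.

Let mq X : measurable_fun D (q X).
Proof.
apply: measurable_funS (measurable_VaR P X) => //.
Qed.

Let mD : measurable D. Proof. exact: measurable_itv. Qed.

Let mu_D : mu D = alpha%:E.
Proof. by rewrite /D lebesgue_measure_itv/= lte_fin alpha0 sube0. Qed.

Let int_cst_D (s : R) : \int[mu]_(b in D) cst s%:E b = (s * alpha)%:E.
Proof. by rewrite EFinM -mu_D; exact: integral_cst. Qed.

Let integrable_cst_D s : mu.-integrable D (EFin \o cst s).
Proof.
apply/integrableP; split; first exact/measurable_EFinP.
rewrite (_ : integral _ _ _ = \int[mu]_(b in D) cst `|s|%:E b)//.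
by rewrite int_cst_D ltry.
Qed.

(** As [q X] is nonincreasing, [q X b - q X alpha] is nonnegative for [b < alpha] and nonpositive
    afterwards. Its positive part over []0, 1[] therefore lives on [D], and [integral_VaR_excess]
    applies. *)
Lemma integral_VaR_excess_eq X :
  \int[mu]_(b in D) (q X b - q X alpha)%:E =
  \int[P]_t (Num.max (- X t - q X alpha) 0)%:E.
Proof.
rewrite -integral_VaR_excess integral_mkcond [RHS]integral_mkcond.
have qle b b' : (0 < b < 1)%R -> (0 < b' < 1)%R -> (b <= b')%R ->
    (q X b' <= q X b)%R.
  move=> b01 b'01 bb'; rewrite fine_le ?VaR_fin_num//.
  exact: VaR_nonincreasing.
apply: eq_integral => b _; rewrite !patchE.
case: ifPn => [|bD].
  rewrite inE => bD; rewrite ifT; last by rewrite inE/= in_itv; exact: subD.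
  rewrite max_l// subr_ge0 (qle _ _ (subD bD) alpha01)//.
  by move: bD; rewrite /D/= in_itv/= => /andP[_ /ltW].
case: ifPn => //; rewrite inE/= in_itv/= => b01.
rewrite max_r// subr_le0 qle// leNgt; apply: contra bD => ba.
by rewrite inE /D/= in_itv/= ba; case/andP: b01 => ->.
Qed.

(** Centred at [q X alpha], the quantile function is nonnegative on [D] and integrates to a finite
    excess; the constant is then added back. *)
Lemma integrable_VaR X : P.-integrable setT (EFin \o X) ->
  mu.-integrable D (EFin \o q X).
Proof.
move=> iX.
have iqv : mu.-integrable D (fun b => (q X b - q X alpha)%:E).
  apply/integrableP; split.
    by apply/measurable_EFinP/measurable_funB => //; exact: mq.
  under eq_integral => b bD.
    rewrite gee0_abs; last first.
      have b01 : (0 < b < 1)%R by apply: subD; rewrite inE in bD.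
      rewrite lee_fin subr_ge0 fine_le ?VaR_fin_num// VaR_nonincreasing//.
      by move: bD; rewrite inE /D/= in_itv/= => /andP[_ /ltW].
    over.
  by rewrite integral_VaR_excess_eq excessE// ltry.
apply: eq_integrable (integrableD _ iqv (integrable_cst_D (q X alpha))) => //.
by move=> b _; rewrite /= -EFinD subrK.
Qed.

Lemma integral_VaRB X s : P.-integrable setT (EFin \o X) ->
  \int[mu]_(b in D) VaR P b X =
  (alpha * s)%:E + \int[mu]_(b in D) (q X b - s)%:E.
Proof.
move=> iX; under [X in _ + X]eq_integral do rewrite EFinB.
rewrite (integralB _ (integrable_VaR iX) (integrable_cst_D s))// int_cst_D.
rewrite (mulrC alpha) [RHS]addeC subeK; last by [].
by apply: eq_integral => b /[!inE] bD; rewrite /= fineK// VaR_fin_num// subD.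
Qed.

(** The upper bound for every level [s]: [q X - s] is at most its positive part, whose integral
    grows when [D] is enlarged to []0, 1[]. *)
Lemma TVaR_le X s : P.-integrable setT (EFin \o X) ->
  TVaR P alpha X <= (s + alpha^-1 * excess X s)%:E.
Proof.
move=> iX; rewrite /TVaR (integral_VaRB s iX).
have iqs : mu.-integrable D (EFin \o (fun b => q X b - s)%R).
  have := integrableB _ (integrable_VaR iX) (integrable_cst_D s).
  by move=> /(_ (measurable_itv _)); apply: eq_integrable.
have le1 : \int[mu]_(b in D) (q X b - s)%:E <= (excess X s)%:E.
  rewrite -excessE// -integral_VaR_excess.
  apply: (@le_trans _ _ (\int[mu]_(b in D) (Num.max (q X b - s) 0)%:E)).
    apply: le_integral => //; first exact: integrable_max0.
    by move=> b _; rewrite lee_fin le_max lexx.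
  apply: ge0_subset_integral => //.
  - by apply/measurable_EFinP; apply: measurable_excess; exact: measurable_VaR.
  - by move=> b _; rewrite lee_fin le_max lexx orbT.
apply: (@le_trans _ _ (alpha^-1%:E * ((alpha * s)%:E + (excess X s)%:E))).
  by rewrite lee_pmul2l ?lte_fin ?invr_gt0// leeD2l.
by rewrite -EFinD -EFinM lee_fin mulrDr mulKf ?gt_eqF.
Qed.

Lemma TVaR_eq X : P.-integrable setT (EFin \o X) ->
  TVaR P alpha X = (q X alpha + alpha^-1 * excess X (q X alpha))%:E.
Proof.
move=> iX; rewrite /TVaR (integral_VaRB (q X alpha) iX).
rewrite integral_VaR_excess_eq excessE//.
by rewrite -EFinD -EFinM mulrDr mulKf ?gt_eqF.
Qed.

Lemma TVaR_fin_num X : P.-integrable setT (EFin \o X) ->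
  TVaR P alpha X \is a fin_num.
Proof. by move/TVaR_eq ->. Qed.

(** The bound for the sum is taken at the sum of the two optimal levels, and the positive part is
    subadditive. *)
Lemma TVaR_subadditive X Y : P.-integrable setT (EFin \o X) ->
  P.-integrable setT (EFin \o Y) ->
  TVaR P alpha (fun t => X t + Y t)%R <= TVaR P alpha X + TVaR P alpha Y.
Proof.
move=> iX iY.
have iXY : P.-integrable setT (EFin \o (X + Y : {mfun T >-> R})%R).
  by apply: eq_integrable (integrableD _ iX iY) => //.
rewrite (TVaR_eq iX) (TVaR_eq iY).
apply: le_trans (TVaR_le (q X alpha + q Y alpha) iXY) _.
rewrite -EFinD lee_fin.
rewrite addrACA -mulrDr lerD2l ler_pM2l ?invr_gt0//.
rewrite -lee_fin EFinD -!excessE// -integralD//; try exact: integrable_excess.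
apply: le_integral => //; first exact: integrable_excess.
  by apply: integrableD => //; exact: integrable_excess.
move=> t _; rewrite -EFinD lee_fin -[(X + Y)%R t]/(X t + Y t)%R.
rewrite ge_max addr_ge0 ?le_max ?lexx ?orbT// andbT.
have -> : (- (X t + Y t) - (q X alpha + q Y alpha) =
  (- X t - q X alpha) + (- Y t - q Y alpha))%R by rewrite opprD opprD addrACA.
by rewrite lerD// le_max lexx.
Qed.

(** The level [a * q X alpha] is used in [TVaR_le]; the positive part commutes with a factor
    [a > 0]. *)
Lemma TVaRZ_le X (a : R) : (0 < a)%R -> P.-integrable setT (EFin \o X) ->
  TVaR P alpha (fun t => a * X t)%R <= a%:E * TVaR P alpha X.
Proof.
move=> a0 iX.
have iaX : P.-integrable setT (EFin \o (a *: X : {mfun T >-> R})%R).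
  by apply: eq_integrable (integrableZl measurableT a iX) => //.
rewrite (TVaR_eq iX); apply: le_trans (TVaR_le (a * q X alpha) iaX) _.
suff -> : excess (a *: X)%R (a * q X alpha) = (a * excess X (q X alpha))%R.
  by rewrite -EFinM lee_fin; lra.
apply: EFin_inj; rewrite EFinM -!excessE//.
rewrite -integralZl//; last exact: integrable_excess.
apply: eq_integral => t _; rewrite -EFinM -[(a *: X)%R t]/(a * X t)%R.
by rewrite maxr_pMr ?ltW// mulr0 mulrBr mulrN.
Qed.

(** Level 0 in [TVaR_le]. This estimate is the source of the Lipschitz constant. *)
Lemma TVaR_le_L1 X : P.-integrable setT (EFin \o X) ->
  TVaR P alpha X <= alpha^-1%:E * \int[P]_t `|(X t)%:E|.
Proof.
move=> iX; apply: le_trans (TVaR_le 0 iX) _; rewrite add0r EFinM.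
rewrite lee_pmul2l ?lte_fin ?invr_gt0// -excessE//.
apply: le_integral => //; first exact: integrable_excess.
  exact: integrable_abse.
move=> t _; rewrite abse_EFin lee_fin subr0 ge_max normr_ge0 andbT.
by rewrite -normrN ler_norm.
Qed.

End rockafellar_uryasev.

(** * Sign of TVaR and the mass of the event of zero payoff *)

Section zero_payoff.
Context d (T : measurableType d) (R : realType) (P : probability T R).
Variables (alpha : R) (alpha01 : (0 < alpha < 1)%R).
Local Open Scope ereal_scope.
Implicit Types X : {mfun T >-> R}.

(** Any [m < - c] leaves a shortfall on all of [{X = c}], hence with probability at least [alpha].
    So [VaR] is at least [- c] at every level below [alpha], and so is the average. *)
Lemma TVaR_ge_atom X c : P.-integrable setT (EFin \o X) ->
  alpha%:E <= P (X @^-1` [set c]) -> (- c)%:E <= TVaR P alpha X.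
Proof.
move=> iX Xc; have /andP[a0 a1] := alpha01.
rewrite /TVaR (integral_VaRB alpha01 (- c) iX).
apply: (@le_trans _ _ (alpha^-1%:E * (alpha * - c)%:E)).
  by rewrite -EFinM mulKf ?gt_eqF.
rewrite lee_pmul2l ?lte_fin ?invr_gt0// leeDl//.
apply: integral_ge0 => b; rewrite /= in_itv/= => /andP[b0 ba].
rewrite lee_fin subr_ge0 -lee_fin fineK; last first.
  by rewrite VaR_fin_num// b0 (lt_trans ba).
apply: le_ereal_inf_tmp => _ [m /= mb <-]; rewrite lee_fin leNgt.
apply/negP => mc.
have : alpha%:E <= b%:E.
  apply: le_trans Xc (le_trans _ mb); apply: le_measure; rewrite ?inE.
  - by rewrite -[X in measurable X]setTI; exact: (measurable_funPT X).
  - exact: measurable_shortfall.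
  - by move=> t /= ->; lra.
by rewrite lee_fin leNgt ba.
Qed.

Lemma TVaR_lt0P X : P.-integrable setT (EFin \o X) ->
  {ae P, forall t, (0 <= X t)%R} ->
  TVaR P alpha X < 0 <-> P (X @^-1` [set 0%R]) < alpha%:E.
Proof.
move=> iX X0; have /andP[a0 a1] := alpha01; split => [|X0a].
  rewrite !ltNge; apply: contra => /(TVaR_ge_atom iX).
  by rewrite oppr0.
have mX0 : measurable (X @^-1` [set 0%R]).
  by rewrite -[X in measurable X]setTI; exact: (measurable_funPT X).
(* Since [X >= 0] almost surely, [{X <= 0}] and [{X = 0}] agree once the null set [N] is adjoined to
   both. *)
have cX0 : cdf (P := P) X 0%R = P (X @^-1` [set 0%R]).
  have [N [mN N0 XN]] := X0.
  have mX0' : measurable (X @^-1` `]-oo, 0%R]) by exact: measurable_sfunP.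
  rewrite -(measureU0 mX0 mN N0)
    -[LHS]/(P (X @^-1` `]-oo, 0%R])) -(measureU0 mX0' mN N0).
  congr (P _); apply/seteqP; split => t /= [|]; try by right.
    rewrite in_itv/= => Xt; case: (pselect (N t)) => [|Nt]; [by right|left].
    apply/eqP; rewrite eq_le Xt leNgt; apply/negP => Xt0; apply/Nt/XN => /=.
    by rewrite leNgt Xt0.
  by move=> ->; left; rewrite in_itv/= lexx.
(* Right-continuity of the cdf at 0. The level [- e] will give TVaR at most
   [- e + e * P(X <= e) / alpha], which is negative. *)
have [e e0 ea] : exists2 e : R, (0 < e)%R & P (X @^-1` `]-oo, e]) < alpha%:E.
  have : nbhs (cdf (P := P) X 0%R) (fun u => u < alpha%:E).
    by rewrite cX0; exact: open_ereal_lt' X0a.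
  move=> /(@cdf_right_continuous _ _ _ P X)[/= e e0 /(_ (e / 2)%R)] eP.
  exists (e / 2)%R; first by rewrite divr_gt0.
  apply: eP; rewrite /= ?divr_gt0//= sub0r normrN gtr0_norm ?divr_gt0//.
  by rewrite ltr_pdivrMr//; lra.
apply: le_lt_trans (TVaR_le alpha01 (- e) iX) _.
have mXe : measurable (X @^-1` `]-oo, e]) by exact: measurable_sfunP.
have PXe_fin : P (X @^-1` `]-oo, e]) \is a fin_num by exact: fin_num_measure.
(* Almost surely [X >= 0], so [(e - X)^+] is at most [e] times the indicator of [{X <= e}]. *)
have eP : (excess P X (- e))%:E <= e%:E * P (X @^-1` `]-oo, e]).
  have mI : measurable_fun [set: T]
      (fun t => (\1_(X @^-1` `]-oo, e]) t)%:E : \bar R).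
    exact/measurable_EFinP/measurable_indic.
  rewrite -excessE// -[X in P X]setIT -integral_indic//.
  rewrite -ge0_integralZl//; last by rewrite lee_fin ltW.
  apply: ae_ge0_le_integral => //.
  - by move=> t _; rewrite lee_fin le_max lexx orbT.
  - apply/measurable_EFinP; apply: measurable_excess.
    exact: measurableT_comp.
  - by move=> t _; rewrite -EFinM lee_fin mulr_ge0// ltW.
  - exact: emeasurable_funM.
  apply: filterS X0 => t Xt _; rewrite -EFinM lee_fin indicE.
  have -> : (t \in X @^-1` `]-oo, e]) = (X t <= e)%R.
    by apply/idP/idP; rewrite inE/= in_itv.
  rewrite ge_max; case: (leP (X t) e) => te; rewrite ?mulr1 ?mulr0.
  - by apply/andP; split; lra.
  - by apply/andP; split; lra.
move: eP ea; rewrite -(fineK PXe_fin) -EFinM lee_fin !lte_fin => eP ea.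
have aP : (alpha^-1 * excess P X (- e) <=
    alpha^-1 * (e * fine (P (X @^-1` `]-oo, e]))))%R.
  by rewrite ler_pM2l ?invr_gt0.
have : (alpha^-1 * (e * fine (P (X @^-1` `]-oo, e]))) < e)%R.
  by rewrite mulrC ltr_pdivrMr// ltr_pM2l.
lra.
Qed.
End zero_payoff.

(** * Comparison of the [L^1] and [L^p] norms on a probability space *)

Lemma L1_le_Lp d (T : measurableType d) (R : realType) (P : probability T R)
    (X : {mfun T >-> R}) (p : R) : (1 <= p)%R ->
  (\int[P]_t `|(X t)%:E| <= 'N[P]_p%:E[EFin \o X])%E.
Proof.
move=> p1; rewrite -(Lnorm1 P (EFin \o X)).
(* For [p > 1] this is Hölder against the constant 1, of norm 1. At [p = 1] the conjugate exponent
   [q] would be [0^-1 = 0], so that case is treated apart. *)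
have [->//|pneq1] := eqVneq p 1%R.
have p_gt1 : (1 < p)%R by rewrite lt_neqAle eq_sym pneq1.
have p0 : (0 < p)%R by rewrite (lt_trans ltr01).
pose q := (1 - p^-1)^-1%R.
have q0 : (0 < q)%R by rewrite invr_gt0 subr_gt0 invf_lt1.
have pq : (p^-1 + q^-1 = 1)%R by rewrite invrK addrC subrK.
have := hoelder P (measurable_funPT X) (measurable_cst (1 : R)) p0 q0 pq.
rewrite Lnorm_cst1 [X in (_ * X)%E](_ : _ = 1%E); last first.
  by rewrite -[RHS](poweR1r q^-1); congr (_ `^ _)%E; exact: probability_setT.
rewrite mule1.
by rewrite (_ : X \* cst 1 = X)%R//; apply/funext => t; rewrite /= mulr1.
Qed.

Section Lp.
Context d (T : measurableType d) (R : realType) (P : probability T R).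
Variables (p : R) (p1 : (1 <= p%:E)%E).
Local Notation Lp := (LfunType P p1).
Implicit Types X Y : Lp.
Local Open Scope ereal_scope.

Lemma Lp_integrable X : P.-integrable setT (EFin \o X).
Proof.
apply/Lfun1_integrable.
by apply: Lfun_subset p1 _ _ _ (LfunP X) => //; exact: fin_num_measure.
Qed.

End Lp.

(** * Finiteness and Lipschitz continuity of the risk measure *)

Lemma abse_sub_le (R : realType) (x y v : \bar R) :
  x \is a fin_num -> y \is a fin_num ->
  (x <= y + v -> y <= x + v -> `|x - y| <= v)%E.
Proof.
case: x y v => [x| |] [y| |] [v| |] //= _ _; rewrite ?leey// -!EFinD !lee_fin.
by move=> xyv yxv; rewrite ler_norml; apply/andP; split; lra.
Qed.

Section risk_functional.
Context d (T : measurableType d) (R : realType) (P : probability T R).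
Variables (p : R) (p1 : (1 <= p%:E)%E) (alpha : R) (S : tradedAsset P p1).
Hypothesis alpha01 : 0 < alpha < 1.
Local Notation Lp := (LfunType P p1).
Implicit Types X Y : Lp.

Let tv X : R := fine (TVaR P alpha X).

Let tvE X : TVaR P alpha X = (tv X)%:E.
Proof. by rewrite fineK// TVaR_fin_num//; exact: Lp_integrable. Qed.

Let tvD X Y : tv (X + Y) <= tv X + tv Y.
Proof.
rewrite -lee_fin EFinD -!tvE.
exact: TVaR_subadditive (Lp_integrable X) (Lp_integrable Y).
Qed.

(** Whatever [m] is, the position started from the constant -1 still equals -1 where the payoff
    vanishes, so [TVaR_ge_atom] gives TVaR at least 1 and the infimum runs over the empty set. *)
Lemma rho_TVaR_pinfty : (alpha%:E <= P (payoff S @^-1` [set 0%R]))%E ->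
  exists X, rho (accTVaR alpha) S X = +oo%E.
Proof.
move=> S0; pose X : Lp := Lfun_Sub p1 (Lfun_cst P (-1) p).
exists X; apply/ereal_inf_pinfty => _ [m mX <-]; exfalso; move: mX.
pose Y : Lp := X + (m / price S) *: payoff S.
suff : ((- -1)%:E <= TVaR P alpha Y)%E.
  rewrite /= -/Y /accTVaR/= => /le_trans/[apply].
  by rewrite opprK lee_fin ler10.
apply: (TVaR_ge_atom alpha01 (Lp_integrable Y)); apply: (le_trans S0).
have mfib (Z : Lp) c : measurable (Z @^-1` [set c]).
  by rewrite -[X in measurable X]setTI; exact: (measurable_funPT Z).
apply: le_measure; rewrite ?inE// => t /= St.
by rewrite -[LHS]/(-1 + (m / price S) * payoff S t) St mulr0 addr0.
Qed.

Hypothesis payoff_lt0 : (TVaR P alpha (payoff S) < 0)%E.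

Let c := - tv (payoff S).

Let c0 : 0 < c.
Proof. by rewrite oppr_gt0 -lte_fin -tvE. Qed.

(** Subadditivity and homogeneity: each unit of the payoff lowers TVaR by at least [c > 0]. *)
Let tv_add_payoff X k : 0 <= k -> tv (X + k *: payoff S) <= tv X - k * c.
Proof.
rewrite le_eqVlt => /predU1P[<-|k0]; first by rewrite scale0r addr0 mul0r subr0.
apply: le_trans (tvD _ _) _; rewrite lerD2l /c mulrN opprK -lee_fin EFinM -!tvE.
exact: TVaRZ_le k0 (Lp_integrable (payoff S)).
Qed.

Let acc X := [set m : R | accTVaR alpha (X + (m / price S) *: payoff S)].

Let accP X m : acc X m <-> tv (X + (m / price S) *: payoff S) <= 0.
Proof. by rewrite -lee_fin -tvE. Qed.

Let S0 : 0 < price S. Proof. exact: price_gt0. Qed.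

Let acc_neq0 X : acc X !=set0.
Proof.
(* Enough units to cancel [tv X], converted to capital by the price; the maximum keeps their number
   nonnegative. *)
exists (price S * (Num.max (tv X) 0 / c)); apply/accP.
rewrite mulrAC mulfV ?gt_eqF// mul1r.
apply: le_trans (tv_add_payoff _ _) _.
  by rewrite divr_ge0 ?(ltW c0)// le_max lexx orbT.
by rewrite divfK ?gt_eqF// subr_le0 le_max lexx.
Qed.

Let acc_lbound X : has_lbound (acc X).
Proof.
exists (price S * Num.min (tv X / c) 0) => m /accP mX.
rewrite mulrC -ler_pdivlMr// ge_min; have [|k0] := leP 0 (m / price S).
  by rewrite orbT.
rewrite ler_pdivrMr// orbF; set k := m / price S in mX k0 *.
(* Buying back the [- k > 0] units sold returns to [X] and yields [tv X <= k * c], a lower bound on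
   [k]. *)
have : tv (X + k *: payoff S + (- k) *: payoff S) <=
    tv (X + k *: payoff S) - (- k) * c.
  by apply: tv_add_payoff; rewrite oppr_ge0 ltW.
rewrite scaleNr addrK mulNr opprK => /le_trans; apply.
by rewrite -[leRHS]add0r lerD2r.
Qed.

Lemma rho_TVaR_fin_num : finitely_valued (rho (accTVaR alpha) S).
Proof.
move=> X.
by rewrite [rho _ _ _](ereal_inf_EFin (acc_lbound X) (acc_neq0 X)).
Qed.

(** An [L^1] distance [i] costs at most [i / alpha] in TVaR, offset by [i / (alpha * c)] units of
    the payoff at [price S] each. *)
Let K := price S / (alpha * c).

Let K0 : 0 <= K.
Proof. by case/andP: alpha01 => a0 _; rewrite ltW// divr_gt0// mulr_gt0. Qed.

Let rho_le X Y : (rho (accTVaR alpha) S Y <=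
  rho (accTVaR alpha) S X + K%:E * \int[P]_t `|(X t - Y t)%:E|)%E.
Proof.
have /andP[a0 _] := alpha01.
have iYX := Lp_integrable (Y - X); have := TVaR_le_L1 alpha01 iYX.
have -> : (\int[P]_t `|((Y - X)%R t)%:E| = \int[P]_t `|(X t - Y t)%:E|)%E.
  by apply: eq_integral => t _; rewrite !abse_EFin distrC.
rewrite tvE => tvYX.
set I := (\int[P]_t `|(X t - Y t)%:E|)%E in tvYX *.
have I0 : (0 <= I)%E by apply: integral_ge0.
have IE : I = (fine I)%:E.
  rewrite fineK//.
  exact: integrable_fin_num (integrable_abse (Lp_integrable (X - Y))).
move: I0 tvYX; rewrite {}IE -!EFinM; move: (fine I) => i {I}.
rewrite !lee_fin => i0 tvYX.
rewrite -leeBlDr//; apply: le_ereal_inf_tmp => _ [m /accP mX <-].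
rewrite leeBlDr//; apply: ereal_inf_lbound.
exists (m + K * i) => //; apply/accP.
(* The position for [Y] is the acceptable one for [X], plus the perturbation [Y - X], plus the extra
   units that compensate it. *)
have -> : Y + ((m + K * i) / price S) *: payoff S =
    X + (m / price S) *: payoff S + (Y - X) + (K * i / price S) *: payoff S.
  rewrite mulrDl scalerDl addrA; congr (_ + _).
  by rewrite [RHS]addrC addrA subrK.
have Ki : K * i / price S = alpha^-1 * i / c.
  by rewrite /K; field; rewrite !gt_eqF.
apply: le_trans (tv_add_payoff _ _) _.
  by apply: divr_ge0; [exact: mulr_ge0|exact: ltW].
rewrite Ki divfK ?gt_eqF// subr_le0; apply: le_trans (tvD _ _) _.
by rewrite -[leRHS]add0r lerD.
Qed.

Lemma rho_TVaR_Lipschitz : Lipschitz_continuous (rho (accTVaR alpha) S).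
Proof.
split; first exact: rho_TVaR_fin_num.
exists K => // X Y.
have fX := rho_TVaR_fin_num X; have fY := rho_TVaR_fin_num Y.
apply: (@le_trans _ _ (K%:E * \int[P]_t `|(X t - Y t)%:E|)%E); last first.
  by rewrite lee_wpmul2l ?lee_fin//; apply: (@L1_le_Lp _ _ _ P (X - Y)).
have YX := rho_le Y X; have XY := rho_le X Y.
rewrite (eq_integral (fun t => `|(X t - Y t)%:E|)%E) in YX; last first.
  by move=> t _; rewrite !abse_EFin distrC.
exact (abse_sub_le fX fY YX XY).
Qed.

End risk_functional.

Unset Implicit Arguments.

Theorem proposition4p4 (d : measure_display) (T : measurableType d)
    (R : realType) (P : probability T R) (p : R) (p1 : (1 <= p%:E)%E)
    (alpha : R) (S : tradedAsset P p1) :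
  nonatomic P ->
  0 < alpha < 1 ->
  [<-> finitely_valued (rho (accTVaR alpha) S);
       Lipschitz_continuous (rho (accTVaR alpha) S);
       (TVaR P alpha (payoff S) < 0)%E;
       (P (payoff S @^-1` [set 0%R]) < alpha%:E)%E].
Proof.
move=> _ alpha01.
have cd := TVaR_lt0P alpha01 (Lp_integrable (payoff S)) (payoff_ge0 S).
(* By contraposition: too large a zero-payoff event forces the value [+oo]. With [cd], this lets
   every implication of the cycle pass through (c) or (d). *)
have ad : finitely_valued (rho (accTVaR alpha) S) ->
    (P (payoff S @^-1` [set 0%R]) < alpha%:E)%E.
  move=> fin; rewrite ltNge; apply/negP.
  by move=> /(rho_TVaR_pinfty alpha01)[X XE]; have := fin X; rewrite XE.
tfae.
- by move=> /ad/cd; exact: rho_TVaR_Lipschitz.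
- by move=> [/ad/cd].
- by move/cd.
- by move/cd; exact: rho_TVaR_fin_num.
Qed.
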